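(* Let $S$ be a finite Kleene relation algebra satisfying the Tarski rule, let $p_0 \in S$ be a forest and let $x \in S$ be a point. Consider the program with program variables $p, t, y$ ranging over $S$, started with $p = p_0$: $y := x$; while $y \neq p^T\cdot y$ do $t := p^T\cdot y$; $p := \big(y \sqcap (p^T\cdot p^T\cdot y)^T\big)\sqcup(\overline{y}\sqcap p)$; $y := t$ od. Then the program terminates, and in its final state: $p$ is a forest; $y$ is a point; $y = ((p^T)^*\cdot x)\sqcap((p\sqcap 1)\cdot\top)$; $p^*\cdot(p^T)^* = p_0^*\cdot(p_0^T)^*$; $p\sqcap 1 = p_0\sqcap 1$; and $p = (v \sqcap (p_0\cdot p_0)) \sqcup (\overline{v}\sqcap p_0)$ where $v = (p_0^T)^*\cdot x$.
   Context: A Kleene relation algebra is a structure $(S,\sqcup,\sqcap,\cdot,\overline{\phantom{x}},{}^T,{}^*,\bot,\top,1)$ such that $(S,\sqcup,\sqcap,\overline{\phantom{x}},\bot,\top)$ is a Boolean algebra with order $x \sqsubseteq y \iff x \sqcup y = y$; $(S,\sqcup,\cdot,\bot,1)$ is an idempotent semiring ($\cdot$ associative with two-sided unit $1$, distributing over $\sqcup$, $\bot$ a two-sided zero of $\cdot$); transposition satisfies $(x\sqcup y)^T = x^T \sqcup y^T$, $(x^T)^T = x$, $(x\cdot y)^T = y^T\cdot x^T$ and $(x\cdot y)\sqcap z \sqsubseteq x\cdot(y\sqcap(x^T\cdot z))$; and the star satisfies $1\sqcup y\cdot y^* = y^* = 1 \sqcup y^*\cdot y$, $z\sqcup y\cdot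 x\sqsubseteq x \Rightarrow y^*\cdot z\sqsubseteq x$, $z \sqcup x\cdot y \sqsubseteq x \Rightarrow z\cdot y^*\sqsubseteq x$. The Tarski rule states $\top\cdot x\cdot\top = \top$ for every $x \neq \bot$. Write $x^+ = x\cdot x^*$. An element $x$ is univalent if $x^T x\sqsubseteq 1$, total if $1\sqsubseteq x x^T$, a mapping if univalent and total, injective if $x x^T\sqsubseteq 1$, surjective if $1\sqsubseteq x^T x$, a vector if $x\cdot\top = x$, a point if it is an injective surjective vector, acyclic if $x^+\sqsubseteq\overline 1$, and a forest if it is a mapping and $x\sqcap\overline{1}$ is acyclic. Programs are sequential while-programs with the usual semantics; $p^T\cdot y$ reads the parent of node $y$, and the assignment to $p$ sets the parent of $y$ to its grandparent. The final equation says $p$ is the array update of $p_0$ at all nodes in $v$ to the value $(p_0\cdot p_0)^T$, i.e. $(v\sqcap ((p_0 p_0)^T)^T)\sqcup(\overline v \sqcap p_0)$. *)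

(* Defs.v *)
From HB Require Import structures.
From mathcomp Require Import all_boot all_order ssralg.

Set Implicit Arguments.
Unset Strict Implicit.
Unset Printing Implicit Defensive.

Import Order.TTheory GRing.Theory.

Declare Scope kra_scope.
Delimit Scope kra_scope with KRA.

Local Open Scope ring_scope.
Local Open Scope order_scope.
Local Open Scope kra_scope.

(* The Boolean algebra is the ctbDistrLatticeType structure of S (so that      *)
(* [x <= y] is equivalent to [x `|` y = y], see leEjoin), and composition and  *)
(* its unit are the product and the unit of the semiring structure of S.       *)
(* [addr_join] and [zeror_bottom] identify the additive monoid of the semiring *)
(* with (S, `|`, \bot), which makes the semiring idempotent. [pzSemiRingType]  *)
(* does not require 1 != 0, so the one-element algebra is included.            *)
HB.mixin Record isKleeneRelAlg (d : Order.disp_t) S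
    of Order.CTBDistrLattice d S & GRing.PzSemiRing S := {
  addr_join : forall x y : S, x + y = x `|` y;
  zeror_bottom : (0 : S) = \bot;
  conv : S -> S;
  star : S -> S;
  conv_join : forall x y : S, conv (x `|` y) = conv x `|` conv y;
  convK : forall x : S, conv (conv x) = x;
  conv_mul : forall x y : S, conv (x * y) = conv y * conv x;
  dedekind : forall x y z : S, (x * y) `&` z <= x * (y `&` (conv x * z));
  star_unfoldl : forall y : S, (1 : S) `|` (y * star y) = star y;
  star_unfoldr : forall y : S, (1 : S) `|` (star y * y) = star y;
  star_inductl : forall x y z : S, z `|` (y * x) <= x -> star y * z <= x;
  star_inductr : forall x y z : S, z `|` (x * y) <= x -> z * star y <= x
}.

#[short(type="kleeneRelAlgType")]
HB.structure Definition KleeneRelAlg (d : Order.disp_t) :=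
  { S of isKleeneRelAlg d S & Order.CTBDistrLattice d S & GRing.PzSemiRing S }.

#[short(type="finKleeneRelAlgType")]
HB.structure Definition FinKleeneRelAlg (d : Order.disp_t) :=
  { S of KleeneRelAlg d S & Finite S }.

Notation "x ^T" := (conv x) : kra_scope.
Notation "x ^*" := (star x) : kra_scope.

Section RelationProperties.
Context {d : Order.disp_t} {S : kleeneRelAlgType d}.
Implicit Types x : S.

Definition rel_plus x : S := x * x^*.

Definition rel_univalent x : bool := x^T * x <= 1.
Definition rel_total x : bool := 1 <= x * x^T.
Definition rel_mapping x : bool := rel_univalent x && rel_total x.
Definition rel_injective x : bool := x * x^T <= 1.
Definition rel_surjective x : bool := 1 <= x^T * x.
Definition rel_vector x : bool := x * \top == x.
Definition rel_point x : bool :=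
  [&& rel_injective x, rel_surjective x & rel_vector x].
Definition rel_acyclic x : bool := rel_plus x <= ~` 1.
Definition rel_forest x : bool := rel_mapping x && rel_acyclic (x `&` ~` 1).

End RelationProperties.

Definition tarski_rule {d : Order.disp_t} (S : kleeneRelAlgType d) : Prop :=
  forall x : S, x != \bot -> \top * x * \top = \top.

Section WhilePrograms.
Variables (V : eqType) (S : Type).

Definition state := V -> S.

Definition upd (s : state) (v : V) (a : S) : state :=
  fun w => if w == v then a else s w.

Inductive com :=
  | Skip
  | Assign of V & (state -> S)
  | Seq of com & com
  | If of (state -> bool) & com & com
  | While of (state -> bool) & com.

(* Big-step semantics: [exec c s s'] holds if c started in s terminates in s'. *)
Inductive exec : com -> state -> state -> Prop :=
  | ExecSkip s : exec Skip s s
  | ExecAssign v e s : exec (Assign v e) s (upd s v (e s))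
  | ExecSeq c1 c2 s1 s2 s3 :
      exec c1 s1 s2 -> exec c2 s2 s3 -> exec (Seq c1 c2) s1 s3
  | ExecIfTrue (b : state -> bool) c1 c2 s s' : b s -> exec c1 s s' -> exec (If b c1 c2) s s'
  | ExecIfFalse (b : state -> bool) c1 c2 s s' : ~~ b s -> exec c2 s s' -> exec (If b c1 c2) s s'
  | ExecWhileFalse (b : state -> bool) c s : ~~ b s -> exec (While b c) s s
  | ExecWhileTrue (b : state -> bool) c s1 s2 s3 :
      b s1 -> exec c s1 s2 -> exec (While b c) s2 s3 -> exec (While b c) s1 s3.

(* Commands are deterministic, so the existence of one terminating execution   *)
(* is termination.                                                             *)
Definition terminates (c : com) (s : state) : Prop := exists s', exec c s s'.

End WhilePrograms.

Variant var := Pv | Tv | Yv.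

Definition nat_of_var (v : var) : nat :=
  match v with Pv => 0 | Tv => 1 | Yv => 2 end.
Definition var_of_nat (n : nat) : var :=
  match n with 0 => Pv | 1 => Tv | _ => Yv end.
Lemma nat_of_varK : cancel nat_of_var var_of_nat. Proof. by case. Qed.
HB.instance Definition _ := Equality.copy var (can_type nat_of_varK).

Definition path_splitting {d : Order.disp_t} {S : finKleeneRelAlgType d}
    (x : S) : com var S :=
  Seq (Assign Yv (fun=> x))
  (While (fun s => s Yv != (s Pv)^T * s Yv)
    (Seq (Assign Tv (fun s => (s Pv)^T * s Yv))
    (Seq (Assign Pv (fun s => (s Yv `&` ((s Pv)^T * (s Pv)^T * s Yv)^T)
                              `|` (~` (s Yv) `&` s Pv)))
         (Assign Yv (fun s => s Tv))))).

(* Main.v *)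
(** Follow the nodes [y_i = (p0^T)^i x].  By acyclicity and the Tarski rule (distinct points
    are disjoint), they are pairwise disjoint until the first [k] with [y_{k+1} = y_k], which
    exists as [S] is finite.  Hence each iteration meets a node not updated so far, and after
    [i] iterations [p] is [p0] with [p0 * p0] written on [y_0, ..., y_{i-1}]; at the root [y_k]
    both maps agree, which gives the last equation.
    Reading [v = (p0^T)^* * x] as a set closed under [p0], every node of [v] reaches the root
    [r = y_k] under the new [p], i.e. [v <= p^* * r].  Therefore each old edge inside [v]
    lies in [v * v^T <= p^* * r * r^T * (p^T)^* <= p^* * (p^T)^*], and components are
    preserved by the Church-Rosser property of univalent relations.  The other claims follow
    from [p0 * p0 <= (p0 `&` 1) `|` rel_plus (p0 `&` ~` 1)]. *)
Require Import Defs.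
From mathcomp Require Import all_boot all_order ssralg.

Import Order.TTheory Order.CTheory GRing.Theory.

Local Open Scope ring_scope.
Local Open Scope order_scope.
Local Open Scope kra_scope.

(** * Basic calculus of composition, converse and the Dedekind law *)

Section RelationAlgebra.
Context {d : Order.disp_t} {S : kleeneRelAlgType d}.
Implicit Types c f g p q r u v w x y z : S.

Lemma relmulUl x y z : (x `|` y) * z = x * z `|` y * z.
Proof. by rewrite -!addr_join mulrDl. Qed.

Lemma relmulUr x y z : z * (x `|` y) = z * x `|` z * y.
Proof. by rewrite -!addr_join mulrDr. Qed.

Lemma relmul0l x : \bot * x = \bot :> S.
Proof. by rewrite -zeror_bottom mul0r. Qed.

Lemma relmul0r x : x * \bot = \bot :> S.
Proof. by rewrite -zeror_bottom mulr0. Qed.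

Lemma le_relmull x z w : z <= w -> x * z <= x * w.
Proof. by rewrite !leEjoin -relmulUr => /eqP->. Qed.

Lemma le_relmulr x y z : x <= y -> x * z <= y * z.
Proof. by rewrite !leEjoin -relmulUl => /eqP->. Qed.

Lemma le_relmul x y z w : x <= y -> z <= w -> x * z <= y * w.
Proof. by move=> xy zw; apply: le_trans (le_relmulr _ _ _ xy) (le_relmull _ _ _ zw). Qed.

Lemma le_conv x y : (x^T <= y^T) = (x <= y).
Proof.
by rewrite !leEjoin -conv_join (inj_eq (can_inj convK)).
Qed.

Lemma le_convl x y : (x^T <= y) = (x <= y^T).
Proof. by rewrite -le_conv convK. Qed.

Lemma conv_meet x y : (x `&` y)^T = x^T `&` y^T.
Proof.
apply/le_anti/andP; split; first by rewrite lexI !le_conv leIl leIr.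
by rewrite -le_convl lexI !le_convl leIl leIr.
Qed.

Lemma conv1 : (1 : S)^T = 1.
Proof. by rewrite -[LHS]mul1r -{1}(convK 1) -conv_mul mul1r convK. Qed.

Lemma conv_top : (\top : S)^T = \top.
Proof. by apply/le_anti; rewrite lex1 -le_convl lex1. Qed.

Lemma conv_bottom : (\bot : S)^T = \bot.
Proof. by apply/le_anti; rewrite le0x le_convl le0x. Qed.

Lemma dedekindr x y z : (x * y) `&` z <= (x `&` (z * y^T)) * y.
Proof.
rewrite -le_conv conv_meet !conv_mul conv_meet conv_mul !convK.
by rewrite -{3}(convK y); apply: dedekind.
Qed.

(** * Star *)

Lemma le1star x : 1 <= x^*.
Proof. by rewrite -star_unfoldl leUl. Qed.

Lemma le_mul_star x : x * x^* <= x^*.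
Proof. by rewrite -{2}star_unfoldl leUr. Qed.

Lemma le_star_mul x : x^* * x <= x^*.
Proof. by rewrite -{2}star_unfoldr leUr. Qed.

Lemma le_star x : x <= x^*.
Proof. by apply: le_trans (le_mul_star x); rewrite -{1}(mulr1 x) le_relmull ?le1star. Qed.

Lemma le_star_transitive x y : 1 <= y -> y * y <= y -> x <= y -> x^* <= y.
Proof.
move=> y1 yy xy; rewrite -(mulr1 (x^*)); apply: star_inductl.
by rewrite leUx y1 (le_trans _ yy) ?le_relmulr.
Qed.

Lemma star_star_mul x : x^* * x^* <= x^*.
Proof. by apply: star_inductl; rewrite leUx lexx le_mul_star. Qed.

Lemma conv_star x : (x^*)^T = (x^T)^*.
Proof.
have sub (y : S) : (y^T)^* <= (y^*)^T.
  apply: le_star_transitive; first by rewrite -le_convl conv1 le1star.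
  - by rewrite -conv_mul le_conv star_star_mul.
  - by rewrite le_conv le_star.
apply/le_anti/andP; split=> //.
by rewrite le_convl -{1}(convK x) sub.
Qed.

(** * Coreflexives, vectors and points *)

(** The Dedekind law gives [b <= b * b^T * b], and for [b <= 1] the outer factors can be enlarged to
    [1]. *)
Lemma conv_coreflexive {c} : c <= 1 -> c^T = c.
Proof.
have sub (b : S) : b <= 1 -> b <= b^T.
  move=> b1; apply: (@le_trans _ _ (b * (b^T * b))).
    have := dedekind b 1 b; rewrite mulr1 meetxx => /le_trans; apply.
    by apply: le_relmull; rewrite leIr.
  apply: (@le_trans _ _ (1 * (b^T * 1))); last by rewrite mul1r mulr1.
  by rewrite !le_relmul.
by move=> c1; apply/le_anti; rewrite le_convl sub.
Qed.

Lemma coreflexive_idem {c} : c <= 1 -> c * c = c.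
Proof.
move=> c1; have cc : c * c <= c by rewrite -{3}(mulr1 c) le_relmull.
apply/le_anti; rewrite cc /=.
have := dedekind c 1 c; rewrite mulr1 meetxx (conv_coreflexive c1).
by move=> /le_trans; apply; apply: le_relmull; apply: le_trans cc; apply: leIr.
Qed.

Lemma vectorP {v} : rel_vector v -> v * \top = v.
Proof. by move/eqP. Qed.

Lemma le_vector_mul {v} x : rel_vector v -> v * x <= v.
Proof. by move=> vv; rewrite -{2}(vectorP vv) le_relmull ?lex1. Qed.

Lemma vector_meet_mul v x y : rel_vector v -> (v `&` x) * y = v `&` (x * y).
Proof.
move=> vv; apply/le_anti/andP; split.
  rewrite lexI (le_trans (le_relmulr _ _ y (leIl _ _)) (le_vector_mul y vv)).
  by rewrite le_relmulr ?leIr.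
rewrite meetC; apply: le_trans (dedekindr _ _ _) _; apply: le_relmulr.
by rewrite meetC leI2 ?le_vector_mul.
Qed.

Lemma conv_vector_meet_mul v x z :
  rel_vector v -> (v `&` x)^T * z = x^T * (v `&` z).
Proof.
move=> vv; rewrite -{1}(mul1r x) -(vector_meet_mul v 1 x vv) conv_mul -mulrA.
by rewrite (conv_coreflexive (leIr _ _)) vector_meet_mul // mul1r.
Qed.

Lemma vectorC v : rel_vector v -> rel_vector (~` v).
Proof.
move=> vv; apply/eqP/le_anti/andP; split; last first.
  by rewrite -{1}(mulr1 (~` v)) le_relmull ?lex1.
rewrite -disj_leC -lex0; apply: le_trans (dedekindr _ _ _) _.
by rewrite conv_top (vectorP vv) meetCx relmul0l.
Qed.

Lemma vectorI v w : rel_vector v -> rel_vector w -> rel_vector (v `&` w).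
Proof. by move=> vv vw; rewrite /rel_vector vector_meet_mul // (vectorP vw). Qed.

Lemma vectorU v w : rel_vector v -> rel_vector w -> rel_vector (v `|` w).
Proof. by move=> vv vw; rewrite /rel_vector relmulUl !vectorP. Qed.

Lemma vector0 : rel_vector (\bot : S).
Proof. by rewrite /rel_vector relmul0l. Qed.

Lemma vector_mul x v : rel_vector v -> rel_vector (x * v).
Proof. by move=> vv; rewrite /rel_vector -mulrA vectorP. Qed.

Lemma point_vector {y} : rel_point y -> rel_vector y.
Proof. by case/and3P. Qed.

Lemma point_inj {y} : rel_point y -> y * y^T <= 1.
Proof. by case/and3P. Qed.

Lemma point_surj {y} : rel_point y -> 1 <= y^T * y.
Proof. by case/and3P. Qed.

Lemma point_conv_mul {f y} : rel_mapping f -> rel_point y -> rel_point (f^T * y).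
Proof.
case/andP=> fu ft yp; apply/and3P; split.
- rewrite /rel_injective conv_mul convK mulrA -(mulrA _ y).
  apply: le_trans fu; apply: le_relmulr; rewrite -{2}(mulr1 (f^T)).
  by apply: le_relmull; exact: point_inj.
- rewrite /rel_surjective conv_mul convK mulrA -(mulrA _ f).
  apply: le_trans (point_surj yp) _; apply: le_relmulr.
  by rewrite -{1}(mulr1 (y^T)) le_relmull.
- exact/vector_mul/point_vector.
Qed.

(** By the Tarski rule a nonzero vector [u] has [\top * u = \top], so it is surjective. For [u <= y]
    this yields [y <= y * u^T * u <= y * y^T * u <= u]. *)
Lemma point_meet_eq0_or_le y v : tarski_rule S ->
  rel_point y -> rel_vector v -> y `&` v = \bot \/ y <= v.
Proof.
move=> HT yp vv; set u := y `&` v.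
have uvec : rel_vector u by apply: vectorI => //; apply: point_vector.
have [->|u0] := eqVneq u \bot; [by left | right].
have tu : \top * u = \top by rewrite -{2}(HT u u0) -mulrA vectorP.
have ut : 1 <= u^T * u.
  have := dedekind (u^T) \top 1.
  rewrite -{1}conv_top -conv_mul tu conv_top meet1x convK mulr1 => /le_trans; apply.
  by rewrite le_relmull ?leIr.
apply: (@le_trans _ _ u); last exact: leIr.
apply: (@le_trans _ _ (y * (u^T * u))); first by rewrite -{1}(mulr1 y) le_relmull.
rewrite mulrA -[X in _ <= X]mul1r; apply: le_relmulr.
by apply: le_trans (point_inj yp); rewrite le_relmull // le_conv leIl.
Qed.

Lemma points_disjoint y z : tarski_rule S ->
  rel_point y -> rel_point z -> y != z -> y `&` z = \bot.
Proof.
move=> HT yp zp; have [//|yz] := point_meet_eq0_or_le y z HT yp (point_vector zp).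
have [|zy] := point_meet_eq0_or_le z y HT zp (point_vector yp); first by rewrite meetC.
by case/negP; apply/eqP/le_anti/andP.
Qed.

(** Connects the assignment in the program, which writes the node [q^T * y] into the row [y], with
    the restriction of the relation [q] to that row. *)
Lemma point_meet_row y q : rel_point y -> y `&` (q^T * y)^T = y `&` q.
Proof.
move=> yp; have yv := point_vector yp; rewrite conv_mul convK.
rewrite -[y^T]mul1r -!(mulrA 1) -{1}(vector_meet_mul y 1 _ yv).
have -> : y `&` q = (y `&` 1) * q by rewrite vector_meet_mul ?mul1r.
set c := y `&` 1; have c1 : c <= 1 by apply: leIr.
apply/le_anti/andP; split.
  rewrite -{1}(coreflexive_idem c1) -mulrA; apply: le_relmull; rewrite mulrA.
  rewrite -[X in _ <= X]mul1r; apply: le_relmulr; apply: le_trans (point_inj yp).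
  by apply: le_relmulr; apply: leIl.
rewrite -{1}(coreflexive_idem c1) -mulrA; apply: le_relmull; apply: le_relmulr.
by rewrite -(conv_coreflexive c1) le_conv leIl.
Qed.

(** A point that meets its own image under [q] must carry a loop of [q]; the Dedekind law produces
    [q]&[(y * y^T)], whose second part is below [1]. *)
Lemma injective_meet_mul y q : rel_injective y -> y `&` (q * y) <= (q `&` 1) * y.
Proof.
move=> yi; rewrite meetC; apply: le_trans (dedekindr _ _ _) _.
by apply: le_relmulr; rewrite leI2.
Qed.

(** As [v] is closed under successors, an edge of [q] starting in [v] also ends in [v]. *)
Lemma vector_meet_le_outer v q : rel_vector v -> q^T * v <= v -> v `&` q <= v * v^T.
Proof.
move=> vv qv.
have le1 : v `&` q <= v^T.
  rewrite -{1}(mul1r q) -vector_meet_mul // -le_convl conv_mul.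
  by apply: le_trans qv; apply: le_relmull; rewrite conv_coreflexive ?leIr ?leIl.
have le2 : v `&` q <= v `&` v^T by rewrite lexI leIl le1.
apply: le_trans le2 _; have := dedekind v \top (v^T).
rewrite vectorP // meet1x => /le_trans; apply; apply: le_relmull.
by rewrite -conv_mul le_conv le_vector_mul.
Qed.

End RelationAlgebra.

(** * Array updates *)

Section Splice.
Context {d : Order.disp_t} {S : kleeneRelAlgType d}.
Implicit Types c f g p q r u v w x y z : S.

(** Array update for a vector [v]: the rows in [v] come from [f], all others from [g]. *)
Definition splice v f g := (v `&` f) `|` (~` v `&` g).

Lemma splice0 f g : splice \bot f g = g.
Proof. by rewrite /splice meet0x compl0 meet1x join0x. Qed.

Lemma splice_join y u f g : splice y f (splice u f g) = splice (u `|` y) f g.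
Proof.
rewrite /splice meetUr complU !meetA joinA -meetUl.
by rewrite (meetC (~` u)) (joinIr y) joinxC meet1x (joinC u).
Qed.

Lemma conv_splice_mul v f g z : rel_vector v ->
  (splice v f g)^T * z = f^T * (v `&` z) `|` g^T * (~` v `&` z).
Proof.
move=> vv; have cv := vectorC v vv.
by rewrite conv_join relmulUl !conv_vector_meet_mul.
Qed.

Lemma conv_splice_mul_in v f g z : rel_vector v -> z <= v ->
  (splice v f g)^T * z = f^T * z.
Proof.
move=> vv zv; rewrite conv_splice_mul // (meet_r zv).
have /eqP -> : ~` v `&` z == \bot by rewrite meetC disj_leC complK.
by rewrite relmul0r joinx0.
Qed.

Lemma conv_splice_mul_out v f g z : rel_vector v -> z `&` v = \bot ->
  (splice v f g)^T * z = g^T * z.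
Proof.
move=> vv zv; rewrite conv_splice_mul // (meetC v) zv relmul0r join0x.
by rewrite (@meet_r _ _ (~` v)) // -disj_leC zv.
Qed.

Lemma splice_mapping v f g : rel_vector v ->
  rel_mapping f -> rel_mapping g -> rel_mapping (splice v f g).
Proof.
move=> vv /andP[fu ft] /andP[gu gt]; have cv := vectorC v vv.
have top_total q : rel_total q -> q * \top = \top.
  move=> qt; apply/le_anti; rewrite lex1 /= -{1}(mul1r \top).
  apply: le_trans (le_relmulr _ _ _ qt) _.
  by rewrite -mulrA le_relmull ?lex1.
apply/andP; split.
  rewrite /rel_univalent conv_splice_mul // /splice !meetUr !meetA meetxC meetCx.
  rewrite !meetxx !meet0x joinx0 join0x leUx.
  by rewrite (le_trans _ fu) ?(le_trans _ gu) // le_relmull ?leIr.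
(* Totality is obtained from this equation by the Dedekind law, as [1] is below the product with
   [\top]. *)
have pt : splice v f g * \top = \top.
  by rewrite relmulUl !vector_meet_mul // !top_total // !meetx1 joinxC.
have := dedekind (splice v f g) \top 1.
by rewrite pt !meet1x mulr1.
Qed.

(** * Shortcuts in forests *)

Lemma plus_mul x : rel_plus x * rel_plus x <= rel_plus x.
Proof.
rewrite /rel_plus -mulrA; apply: le_relmull; apply: le_trans (star_star_mul x).
by rewrite mulrA le_relmulr ?le_star_mul.
Qed.

Lemma le_plus x : x <= rel_plus x.
Proof. by rewrite -{1}(mulr1 x) le_relmull ?le1star. Qed.

Lemma plus_least x y : x <= y -> y * y <= y -> rel_plus x <= y.
Proof.
move=> xy yy; apply: star_inductr; rewrite leUx xy.
by apply: le_trans yy; apply: le_relmull.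
Qed.

Lemma meet1C f : f = (f `&` 1) `|` (f `&` ~` 1).
Proof. by rewrite -meetUr joinxC meetx1. Qed.

(** Splitting [f] into loops and proper edges, a loop acts as a subidentity in the product, so only
    two proper edges compose to something new, a path of length two. *)
Lemma forest_square_le f :
  f * f <= (f `&` 1) `|` rel_plus (f `&` ~` 1).
Proof.
rewrite {1 2}(meet1C f); set c := f `&` 1; set w := f `&` ~` 1.
have c1 : c <= 1 by apply: leIr.
rewrite relmulUl !relmulUr !leUx; apply/andP; split; apply/andP; split.
- by rewrite (coreflexive_idem c1) leUl.
- apply: le_trans (le_relmulr _ _ _ c1) _; rewrite mul1r.
  by apply: le_trans (le_plus w) (leUr _ _).
- apply: le_trans (le_relmull _ _ _ c1) _; rewrite mulr1.
  by apply: le_trans (le_plus w) (leUr _ _).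
- by apply: le_trans (leUr _ _); apply: le_relmull; apply: le_star.
Qed.

Lemma forest_square_diag f : rel_forest f -> (f * f) `&` 1 = f `&` 1.
Proof.
case/andP=> _ fa; apply/le_anti/andP; split; rewrite lexI leIr andbT.
  apply: le_trans (leI2 (forest_square_le f) (lexx 1)) _.
  have /eqP w0 : rel_plus (f `&` ~` 1) `&` 1 == \bot by rewrite disj_leC.
  by rewrite meetUl w0 joinx0 -meetA leIl.
by rewrite -{1}(coreflexive_idem (leIr 1 f)) le_relmul // leIl.
Qed.

Lemma forest_splice_diag v f : rel_forest f ->
  splice v (f * f) f `&` 1 = f `&` 1.
Proof.
move=> ff; rewrite /splice meetUl -!meetA forest_square_diag //.
by rewrite -meetUl joinxC meet1x.
Qed.

Lemma mul_mapping f g : rel_mapping f -> rel_mapping g -> rel_mapping (f * g).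
Proof.
case/andP=> fu ft /andP[gu gt]; apply/andP; split.
  rewrite /rel_univalent conv_mul mulrA -(mulrA _ (f^T)); apply: le_trans gu.
  by apply: le_relmulr; rewrite -{2}(mulr1 (g^T)); apply: le_relmull.
rewrite /rel_total conv_mul mulrA -(mulrA f); apply: le_trans ft _.
by apply: le_relmulr; rewrite -{1}(mulr1 f); apply: le_relmull.
Qed.

Lemma splice_forest v f : rel_vector v -> rel_forest f ->
  rel_forest (splice v (f * f) f).
Proof.
move=> vv ff; have /andP[fm fa] := ff; apply/andP; split.
  by apply: splice_mapping => //; apply: mul_mapping.
(* The proper edges of the new relation are paths of proper edges of [f]; these form a transitive
   relation that avoids the identity. *)
apply: le_trans fa; apply: plus_least; last exact: plus_mul.
have le : splice v (f * f) f <= (f `&` 1) `|` rel_plus (f `&` ~` 1).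
  rewrite leUx; apply/andP; split; apply: le_trans (leIr _ _) _.
    exact: forest_square_le.
  by rewrite {1}(meet1C f) leU2 ?le_plus.
apply: le_trans (leI2 le (lexx _)) _; rewrite meetUl leUx leIl andbT.
by rewrite -meetA meetxC meetx0 le0x.
Qed.

(** Star induction moves one [p^T] at a time across [p^*]: it either meets no step, or cancels the
    first one through [p^T * p <= 1]. *)
Lemma univalent_church_rosser p : rel_univalent p ->
  (p^T)^* * p^* <= p^* * (p^T)^*.
Proof.
move=> pu; apply: star_inductl; rewrite leUx; apply/andP; split.
  by rewrite -{1}(mulr1 (p^*)) le_relmull ?le1star.
rewrite mulrA -{1}(star_unfoldl p) relmulUr mulr1 relmulUl leUx; apply/andP; split.
  rewrite -[X in X <= _]mul1r; apply: le_relmul; first exact: le1star.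
  exact: le_mul_star.
apply: le_relmulr; rewrite mulrA -[X in _ <= X]mul1r; exact: le_relmulr.
Qed.

Lemma univalent_equiv_trans p : rel_univalent p ->
  (p^* * (p^T)^*) * (p^* * (p^T)^*) <= p^* * (p^T)^*.
Proof.
move=> pu; rewrite mulrA -(mulrA (p^*)).
apply: le_trans (le_relmulr _ _ _ (le_relmull _ _ _ (univalent_church_rosser p pu))) _.
rewrite mulrA -mulrA; apply: le_relmul; exact: star_star_mul.
Qed.

Lemma splice_components v f r : rel_vector v -> f^T * v <= v -> rel_injective r ->
    rel_mapping f -> let p := splice v (f * f) f in
  v <= p^* * r -> p^* * (p^T)^* = f^* * (f^T)^*.
Proof.
move=> vv fv ri fm p vr; have /andP[fu ft] := fm.
have /andP[pu pt] : rel_mapping p by apply: splice_mapping => //; apply: mul_mapping.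
apply/le_anti/andP; split.
  have pf : p^* <= f^*.
    apply: le_star_transitive; rewrite ?le1star ?star_star_mul //.
    rewrite leUx; apply/andP; split; apply: le_trans (leIr _ _) _; last exact: le_star.
    by apply: le_trans (le_mul_star f); apply: le_relmull; apply: le_star.
  by apply: le_relmul => //; rewrite -!conv_star le_conv.
(* [E] is an equivalence, so it contains [f^* * (f^T)^*] as soon as it contains [f]. *)
set E := p^* * (p^T)^*.
have EE : E * E <= E by apply: univalent_equiv_trans.
have E1 : 1 <= E by rewrite -[X in X <= _]mul1r le_relmul ?le1star.
have ET : E^T = E by rewrite conv_mul !conv_star convK.
(* Inside [v] both ends of an edge reach the same [r]; outside [v] the edge belongs to [p]. *)
have fE : f <= E.
  rewrite -{1}(meet1x f) -(joinxC v) meetUl leUx; apply/andP; split.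
    apply: le_trans (vector_meet_le_outer v f vv fv) _.
    have : v * v^T <= p^* * r * (p^* * r)^T by apply: le_relmul; rewrite ?le_conv.
    move=> /le_trans; apply; rewrite conv_mul conv_star -mulrA (mulrA r).
    by apply: le_relmull; rewrite -[X in _ <= X]mul1r; apply: le_relmulr.
  apply: (@le_trans _ _ p); first exact: leUr.
  apply: le_trans (le_star p) _; rewrite -{1}(mulr1 (p^*)).
  by rewrite le_relmull ?le1star.
have fsE : f^* <= E by apply: le_star_transitive.
apply: le_trans EE; apply: le_relmul => //.
by rewrite -conv_star le_convl ET.
Qed.

(** With [c = p]&[1], one step is absorbed by [c * p = c * c * p <= c * p^T * p <= c]. *)
Lemma univalent_loops_star p : rel_univalent p -> (p `&` 1) * p^* <= p `&` 1.
Proof.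
move=> pu; have c1 := leIr 1 p; apply: star_inductr; rewrite leUx lexx /=.
rewrite -{1}(coreflexive_idem c1) -mulrA -{3}(mulr1 (p `&` 1)).
apply: le_relmull; apply: le_trans pu; apply: le_relmulr.
by rewrite -(conv_coreflexive c1) le_conv leIl.
Qed.

(* A node with a loop reaches only itself, so [r] is the only root of [v]. *)
Lemma root_unique v p x r : rel_mapping p -> rel_point x -> rel_point r ->
    v <= p^* * r -> (p^T)^* * x <= v -> p^T * r = r ->
  r = ((p^T)^* * x) `&` ((p `&` 1) * \top).
Proof.
move=> /andP[pu pt] xp rp vr xv pr; have ri := point_inj rp.
apply/le_anti/andP; split; last first.
  apply: le_trans (leI2 xv (lexx _)) _.
  have c1 := leIr 1 p; rewrite meetC; apply: le_trans (dedekind _ _ _) _.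
  rewrite meet1x (conv_coreflexive c1) mulrA (coreflexive_idem c1).
  apply: le_trans (le_relmull _ _ _ vr) _; rewrite mulrA -[X in _ <= X]mul1r.
  by apply: le_relmulr; apply: le_trans (univalent_loops_star p pu) c1.
rewrite lexI; apply/andP; split.
  (* Since [x] reaches [r], the pair [r * x^T] lies in [(p^T)^*]; surjectivity of [x] then gives
     [r <= r * x^T * x]. *)
  have xr : x <= p^* * r.
    by apply: le_trans vr; apply: le_trans xv; rewrite -{1}(mul1r x) le_relmulr ?le1star.
  have rx : r * x^T <= (p^T)^*.
    rewrite -conv_star -le_convl conv_mul convK.
    apply: le_trans (le_relmulr _ _ _ xr) _; rewrite -mulrA -{2}(mulr1 (p^*)).
    exact: le_relmull.
  apply: le_trans (le_relmulr _ _ x rx); rewrite -mulrA -{1}(mulr1 r).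
  exact/le_relmull/point_surj.
(* By totality [r <= p * p^T * r], so [r] is also its own predecessor and therefore has a loop. *)
have rpr : r <= p * r.
  by rewrite -{2}pr mulrA -{1}(mul1r r); apply: le_relmulr.
apply: (@le_trans _ _ (r `&` (p * r))); first by rewrite lexI lexx.
by apply: le_trans (injective_meet_mul r p ri) _; rewrite le_relmull ?lex1.
Qed.

End Splice.

(** * Paths to the root *)

Section Trail.
Context {d : Order.disp_t} {S : kleeneRelAlgType d}.
Implicit Types f q r v w x y z : S.

Definition trail f x n : S := iter n (fun y => f^T * y) x.

(** The bound is strict: these are the rows already overwritten when the program stands at
    [trail f x n]. *)
Definition visited f x n : S := \join_(i < n) trail f x i.

Lemma trail_point f x n : rel_mapping f -> rel_point x -> rel_point (trail f x n).
Proof. by move=> fm xp; elim: n => //= n; apply: point_conv_mul. Qed.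

Lemma visited_vector f x n : rel_mapping f -> rel_point x -> rel_vector (visited f x n).
Proof.
move=> fm xp; rewrite /visited; elim/big_ind: _ => [||i _]; first exact: vector0.
- exact: vectorU.
- exact/point_vector/trail_point.
Qed.

Lemma visitedS f x n : visited f x n.+1 = visited f x n `|` trail f x n.
Proof. exact: big_ord_recr. Qed.

Lemma trail_fixed f x k n : f^T * trail f x k = trail f x k -> (k <= n)%N ->
  trail f x n = trail f x k.
Proof. by move=> fix_k /subnK <-; elim: (n - k)%N => //= m ->. Qed.

Lemma conv_mul_visited f x n : f^T * visited f x n <= visited f x n.+1.
Proof.
elim: n => [|n IHn]; first by rewrite /visited big_ord0 relmul0r le0x.
rewrite visitedS relmulUr leUx; apply/andP; split.
  by apply: le_trans IHn _; rewrite [X in _ <= X]visitedS leUl.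
by rewrite [X in _ <= X]visitedS leUr.
Qed.

Lemma trail_le_star f x n : trail f x n <= (f^T)^* * x.
Proof.
elim: n => [|n IHn] /=; first by rewrite -{1}(mul1r x) le_relmulr ?le1star.
apply: le_trans (le_relmull _ _ _ IHn) _.
by rewrite mulrA le_relmulr ?le_mul_star.
Qed.

(** At a fixed point the finite join becomes closed under [f^T], so star induction applies; the
    bound [k.+1] includes the root. *)
Lemma visitedE f x k : f^T * trail f x k = trail f x k ->
  (f^T)^* * x = visited f x k.+1.
Proof.
move=> fix_k; apply/le_anti/andP; split.
  apply: star_inductl; rewrite leUx; apply/andP; split.
    by rewrite /visited big_ord_recl; apply: leUl.
  apply: le_trans (conv_mul_visited _ _ _) _.
  by rewrite visitedS /= fix_k leUx lexx visitedS leUr.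
apply/joinsP => i _; exact: trail_le_star.
Qed.

Context (HT : tarski_rule S).

(** The loop part [(f]&[1) * y] lies below both [y] and [f^T * y], which are distinct points and
    hence disjoint. *)
Lemma loopless_step f y : rel_mapping f -> rel_point y -> y != f^T * y ->
  f^T * y = (f `&` ~` 1)^T * y.
Proof.
move=> fm yp yfy; have fyp := point_conv_mul fm yp.
have c1 := leIr 1 f.
rewrite {1}(meet1C f) conv_join relmulUl (conv_coreflexive c1).
suff -> : (f `&` 1) * y = \bot by rewrite join0x.
apply/le_anti; rewrite le0x andbT -(points_disjoint y _ HT yp fyp yfy) lexI.
rewrite -{2}(mul1r y) le_relmulr //= le_relmulr //.
by rewrite -(conv_coreflexive c1) le_conv leIl.
Qed.

Lemma trail_disjoint f x i n : rel_forest f -> rel_point x ->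
    (forall l, (l < i + n.+1)%N -> trail f x l != trail f x l.+1) ->
  trail f x (i + n.+1) `&` trail f x i = \bot.
Proof.
case/andP=> fm fa xp; set w := f `&` ~` 1; rewrite addnS => nofix.
have yp j := trail_point f x j fm xp.
(* All steps in between are proper, so the later node is reached by a nonempty path of proper edges;
   an overlap would give [rel_plus w] a loop. *)
suff reach : trail f x (i + n).+1 <= (rel_plus w)^T * trail f x i.
  apply/le_anti; rewrite le0x andbT meetC.
  apply: le_trans (leI2 (lexx _) reach) _.
  apply: le_trans (injective_meet_mul _ _ (point_inj (yp i))) _.
  suff -> : (rel_plus w)^T `&` 1 = \bot by rewrite relmul0l.
  have /eqP w0 : rel_plus w `&` 1 == \bot by rewrite disj_leC.
  by rewrite -conv1 -conv_meet w0 conv_bottom.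
elim: n nofix => [|n IHn] nofix.
  rewrite addn0 /= loopless_step // ?le_relmulr ?le_conv ?le_plus //.
  by apply: nofix; rewrite addn0.
rewrite addnS; set m := (i + n).+1 in nofix *.
have -> : trail f x m.+1 = w^T * trail f x m.
  by apply: (loopless_step f (trail f x m)) (fm) (yp m) (nofix m _); rewrite /m addnS.
apply: (@le_trans _ _ (w^T * ((rel_plus w)^T * trail f x i))).
  by apply: le_relmull; apply: IHn => l ln; apply: nofix; rewrite addnS ltnS ltnW.
rewrite mulrA -conv_mul; apply: le_relmulr.
by rewrite le_conv; apply: le_trans (le_relmull _ _ _ (le_plus w)) (plus_mul w).
Qed.

Lemma visited_disjoint f x k i j : rel_forest f -> rel_point x ->
    (forall l, (l < k)%N -> trail f x l != trail f x l.+1) ->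
  (i <= j)%N -> (j <= k)%N -> trail f x j `&` visited f x i = \bot.
Proof.
move=> ff xp nofix ij jk; rewrite /visited; elim/big_ind: _ => [|a b|l _].
- by rewrite meetx0.
- by rewrite meetUr => -> ->; rewrite joinx0.
have lj : (l < j)%N := leq_trans (ltn_ord l) ij.
rewrite -(subnKC lj) addSnnS; apply: trail_disjoint => // m.
by rewrite -addSnnS subnKC // => mj; apply: nofix; apply: leq_trans jk.
Qed.

Lemma visited_reach f x k : rel_mapping f -> rel_point x ->
    f^T * trail f x k = trail f x k ->
  (f^T)^* * x <= (splice ((f^T)^* * x) (f * f) f)^* * trail f x k.
Proof.
move=> fm xp fix_k; set v := _ * x; set p := splice _ _ _.
have vv : rel_vector v by apply/vector_mul/point_vector.
have /andP[_ pt] : rel_mapping p.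
  by apply: splice_mapping => //; apply: mul_mapping.
have base : trail f x k <= p^* * trail f x k.
  by rewrite -{1}(mul1r (trail f x k)) le_relmulr ?le1star.
(* [n] bounds the distance to the root. One step of [p] advances by two nodes, and overshooting [k]
   is harmless because the trail is constant from there on. *)
have reach n i : (k <= i + n)%N -> trail f x i <= p^* * trail f x k.
  elim: n i => [|n IHn] i kin; first by rewrite (trail_fixed f x k i) // -(addn0 i).
  have step : p^T * trail f x i = trail f x i.+2.
    rewrite conv_splice_mul_in //; last exact: trail_le_star.
    by rewrite conv_mul -mulrA.
  apply: (@le_trans _ _ (p * (p^T * trail f x i))).
    by rewrite mulrA -{1}(mul1r (trail f x i)) le_relmulr.
  rewrite step; apply: le_trans (le_relmull _ _ _ (IHn i.+2 _)) _.
    by rewrite (leq_trans kin) // addnS !addSn ltnW.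
  by rewrite mulrA le_relmulr ?le_mul_star.
by rewrite /v (visitedE f x k fix_k); apply/joinsP => i _; apply: (reach k); apply: leq_addl.
Qed.

End Trail.

Lemma trail_stops (d : Order.disp_t) (S : finKleeneRelAlgType d) (f x : S) :
    tarski_rule S -> rel_forest f -> rel_point x ->
  exists k, trail f x k == trail f x k.+1.
Proof.
move=> HT ff xp; pose t (i : 'I_#|S|.+1) := trail f x i.
(* Pigeonhole: one more node than [S] has elements. *)
have : ~~ injectiveb t.
  apply/injectiveP => /leq_card; by rewrite card_ord ltnn.
case/injectivePn => i [j ij tij].
wlog lt_ij : i j ij tij / (i < j)%N.
  by move=> wl; move: (ij); rewrite -val_eqE neq_ltn => /orP[|] ?;
    [apply: (wl i j) | apply: (wl j i) => //; rewrite eq_sym].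
have [/existsP[l hl]|/existsPn nofix] := boolP [exists l : 'I_j, trail f x l == trail f x l.+1].
  by exists l.
exists i; have := trail_disjoint HT f x i (j - i.+1) ff xp.
rewrite -addSnnS subnKC // => dis.
(* Two equal but disjoint nodes are [\bot], which [f^T] fixes. So [i] is a witness, with no
   contradiction needed; the one-element algebra is covered. *)
have ti : trail f x i = \bot.
  rewrite -[LHS]meetxx -{1}/(t i) tij dis // => l lj; exact: (nofix (Ordinal lj)).
by rewrite /= -/(trail f x i) ti relmul0r.
Qed.

(** * The program *)

Section Semantics.
Variables (V : eqType) (S : Type).

Lemma exec_deterministic (c : com V S) s s1 s2 : exec c s s1 -> exec c s s2 -> s1 = s2.
Proof.
move=> H; elim: H s2 => {c s s1}.
- by move=> s s2 H; inversion H.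
- by move=> v e s s2 H; inversion H.
- move=> c1 c2 s s' s1 _ IH1 _ IH2 s2 H; inversion H; subst.
  by apply: IH2; rewrite (IH1 _ H2).
- move=> b c1 c2 s s1 bs _ IH s2 H; inversion H; subst; first exact: IH.
  by rewrite bs in H5.
- move=> b c1 c2 s s1 bs _ IH s2 H; inversion H; subst; last exact: IH.
  by rewrite H5 in bs.
- move=> b c s bs s2 H; inversion H; subst => //.
  by rewrite H2 in bs.
- move=> b c s s' s1 bs _ IH1 _ IH2 s2 H; inversion H; subst.
    by rewrite bs in H4.
  by apply: IH2; rewrite (IH1 _ H3).
Qed.

End Semantics.

Lemma path_splitting_exec (d : Order.disp_t) (S : finKleeneRelAlgType d) (f x : S) k s :
    tarski_rule S -> rel_forest f -> rel_point x -> s Pv = f ->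
    (forall l, (l < k)%N -> trail f x l != trail f x l.+1) ->
    trail f x k = trail f x k.+1 ->
  exists2 s', exec (path_splitting x) s s' &
    s' Pv = splice (visited f x k) (f * f) f /\ s' Yv = trail f x k.
Proof.
move=> HT ff xp sp nofix fix_k; have /andP[fm _] := ff.
have vv i := visited_vector f x i fm xp.
have yp i := trail_point f x i fm xp.
(* Only rows before [i] have been changed, so from [i] on the current array still yields the
   original parent. *)
have step i j : (i <= j)%N -> (j <= k)%N ->
    (splice (visited f x i) (f * f) f)^T * trail f x j = trail f x j.+1.
  by move=> ij jk; rewrite conv_splice_mul_out // (visited_disjoint HT f x k).
rewrite /path_splitting; set W := While _ _.
(* [n] counts the remaining iterations, [i] the completed ones. *)
suff loop n : forall i s0, (i + n = k)%N ->
    s0 Pv = splice (visited f x i) (f * f) f -> s0 Yv = trail f x i ->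
  exists2 s', exec W s0 s' &
    s' Pv = splice (visited f x k) (f * f) f /\ s' Yv = trail f x k.
  have [||s' run fin] := loop k 0%N (upd s Yv x) (add0n k) => //.
    by rewrite /upd /= sp /visited big_ord0 splice0.
  by exists s' => //; apply: ExecSeq run; apply: ExecAssign.
elim: n => [|n IHn] i s0 ink p0 y0.
  have ik : i = k by rewrite -ink addn0.
  exists s0; last by rewrite p0 y0 ik.
  by apply: ExecWhileFalse; rewrite p0 y0 step ?ik // fix_k eqxx.
have lt_ik : (i < k)%N by rewrite -ink addnS ltnS leq_addr.
set s1 := upd s0 Tv ((s0 Pv)^T * s0 Yv).
set s2 := upd s1 Pv ((s1 Yv `&` ((s1 Pv)^T * (s1 Pv)^T * s1 Yv)^T)
                              `|` (~` (s1 Yv) `&` s1 Pv)).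
set s3 := upd s2 Yv (s2 Tv).
have [|||s' run fin] := IHn i.+1 s3; first by rewrite addSnnS.
- have -> : s3 Pv = splice (trail f x i) (f * f) (splice (visited f x i) (f * f) f).
    (* The grandparent is read in two lookups, at [trail f x i] and [trail f x i.+1]; both rows are
       still unmodified since [i < k]. *)
    rewrite /s3 /s2 /s1 /upd /= p0 y0 -mulrA !step ?(ltnW lt_ik) //.
    have -> : trail f x i.+2 = (f * f)^T * trail f x i by rewrite conv_mul -mulrA.
    by rewrite point_meet_row.
  by rewrite splice_join visitedS.
- by rewrite /s3 /s2 /s1 /upd /= p0 y0 step // ltnW.
exists s' => //; apply: ExecWhileTrue (run).
  by rewrite p0 y0 step ?nofix // ltnW.
apply: ExecSeq; first exact: ExecAssign.
by apply: ExecSeq; apply: ExecAssign.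
Qed.

Theorem mainTheorem18 (d : Order.disp_t) (S : finKleeneRelAlgType d)
  (HT : tarski_rule S) (p0 x : S)
  (Hp0 : rel_forest p0) (Hx : rel_point x)
  (s : state var S) (Hs : s Pv = p0) :
  terminates (path_splitting x) s /\
  forall s' : state var S, exec (path_splitting x) s s' ->
    let p := s' Pv in
    let y := s' Yv in
    let v := (p0^T)^* * x in
    [/\ rel_forest p,
        rel_point y,
        y = ((p^T)^* * x) `&` ((p `&` 1) * \top) &
        [/\ p^* * (p^T)^* = p0^* * (p0^T)^*,
            p `&` 1 = p0 `&` 1 &
            p = (v `&` (p0 * p0)) `|` (~` v `&` p0)]].
Proof.
have fm : rel_mapping p0 by case/andP: Hp0.
have stops := trail_stops d S p0 x HT Hp0 Hx.
(* The least such [k] is needed: it is the exact number of iterations. *)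
case: (ex_minnP stops) => k /eqP fix_k min_k.
have nofix l : (l < k)%N -> trail p0 x l != trail p0 x l.+1.
  by move=> lk; apply: contraL lk => /min_k; rewrite leqNgt.
have [s1 run [p1 y1]] := path_splitting_exec d S p0 x k s HT Hp0 Hx Hs nofix fix_k.
split; first by exists s1.
(* By determinism every final state is the one just constructed. *)
move=> s' /(exec_deterministic _ _ _ _ _ _ run) <- p y v.
have fix_k' : p0^T * trail p0 x k = trail p0 x k by rewrite {2}fix_k.
have yp : rel_point y by rewrite /y y1; apply: trail_point.
have vv : rel_vector v by apply/vector_mul/point_vector.
have yv : y <= v by rewrite /y y1; apply: trail_le_star.
have fv : p0^T * v <= v by rewrite /v mulrA le_relmulr ?le_mul_star.
have fy : p0^T * y = y by rewrite /y y1.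
have ffy : (p0 * p0)^T * y = y by rewrite conv_mul -mulrA !fy.
have pE : p = splice v (p0 * p0) p0.
  have uv := visited_vector p0 x k fm Hx.
  have uy : y `&` visited p0 x k = \bot.
    by rewrite /y y1; apply: (visited_disjoint HT p0 x k).
  rewrite /v (visitedE _ _ _ fix_k') visitedS -splice_join -y1 -p1 -/y -/p.
  have py : p^T * y = y by rewrite /p p1 conv_splice_mul_out.
  (* The loop never writes the row of the root [y], although [y] belongs to [v]. Writing it changes
     nothing: [p0 * p0] and [p] both send [y] to itself, and the image of a point determines its
     row. *)
  have -> : splice y (p0 * p0) p = splice y p p.
    by rewrite /splice -(point_meet_row y (p0 * p0) yp) -(point_meet_row y p yp) ffy py.
  by rewrite /splice -meetUl joinxC meet1x.
have vr : v <= p^* * y by rewrite pE /y y1; apply: visited_reach.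
have py : p^T * y = y by rewrite pE conv_splice_mul_in.
have pv : (p^T)^* * x <= v.
  apply: star_inductl; rewrite leUx; apply/andP; split.
    by rewrite -{1}(mul1r x) le_relmulr ?le1star.
  by rewrite pE conv_splice_mul_in // conv_mul -mulrA (le_trans (le_relmull _ _ _ fv)).
have pf : rel_forest p by rewrite pE; apply: splice_forest.
have pm : rel_mapping p by case/andP: pf.
split=> //; first exact: (root_unique v).
split=> //; last by rewrite pE forest_splice_diag.
by rewrite pE; apply: (splice_components v p0 y) => //; [exact: point_inj | rewrite -pE].
Qed.
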